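(* Let $G$ and $G'$ be the knot groups of tame knots $K,K'\subset S^3$ ($K$ nontrivial) with meridians $m\in G$ and $m'\in G'$. Assume there is an isomorphism of topological groups $\Phi:\widehat G\xrightarrow{\ \cong\ }\widehat G'$ that sends the conjugacy class of $\overline{\langle m\rangle}^{\,\widehat G}$ to the conjugacy class of $\overline{\langle m'\rangle}^{\,\widehat G'}$; equivalently, there exists $y\in\widehat G'$ with $$\Phi\big(\overline{\langle m\rangle}^{\,\widehat G}\big)=y\,\overline{\langle m'\rangle}^{\,\widehat G'}\,y^{-1}.$$ Fix such a $y$. Let $\widehat U\le\widehat G$ be any open subgroup and set $\widehat U':=\Phi(\widehat U)$. Then for every $x\in\widehat G$ one has $$\Phi\big(\widehat I_x(\widehat U)\big)=\widehat I_{\Phi(x)y}(\widehat U'),$$ where the inertia subgroup on the right is computed using $m'$. In particular, $\Phi$ induces a bijection between the family of closed inertia subgroups $\{\widehat I_x(\widehat U):x\in\widehat G\}$ of $\widehat U$ and the family of closed inertia subgroups $\{\widehat I_{x'}(\widehat U'):x'\in\widehat G'\}$ of $\widehat U'$.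
   Context: For a tame knot $K\subset S^3$ with tubular neighbourhood $\nu(K)$, let $X_K=S^3\setminus\operatorname{int}(\nu(K))$ be the knot exterior, $x_0\in\partial X_K$ a basepoint, and $G=\pi_1(X_K,x_0)$ the knot group. A meridian is an element of $\pi_1(\partial X_K,x_0)$ represented by a simple closed curve on the torus $\partial X_K$ bounding an embedded disk in $\nu(K)$ that meets $K$ once; $m\in G$ denotes the image of a chosen meridian in $G$. The same notation with primes is used for $K'$. $\widehat G$ is the profinite completion of $G$, with $G$ viewed as a dense subgroup, and $\overline{\langle m\rangle}^{\,\widehat G}$ is the closure of $\langle m\rangle$ in $\widehat G$. For an open subgroup $\widehat U\le\widehat G$ and $x\in\widehat G$, the closed inertia subgroup is $\widehat I_x(\widehat U):=\widehat U\cap x\,\overline{\langle m\rangle}^{\,\widehat G}\,x^{-1}$; for an open subgroup $\widehat U'\le\widehat G'$ and $x'\in\widehat G'$ it is $\widehat I_{x'}(\widehat U'):=\widehat U'\cap x'\,\overline{\langle m'\rangle}^{\,\widehat G'}\,x'^{-1}$. *)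

(* Defs.v *)
From HB Require Import structures.
From mathcomp Require Import all_boot all_order all_algebra.
From mathcomp Require Import generic_quotient.
From mathcomp Require Import all_classical reals topology normedtype.
From mathcomp Require Import homotopy.
From mathcomp Require Import ring lra.
Set Implicit Arguments.
Unset Strict Implicit.
Unset Printing Implicit Defensive.
Import Order.TTheory GRing.Theory Num.Theory numFieldNormedType.Exports.
Local Open Scope classical_set_scope.
Local Open Scope ring_scope.

Definition unit_interval (R : realType) : Type := set_type (`[0, 1]%classic : set R).

Section UnitInterval.
Context {R : realType}.
Local Notation I := (unit_interval R).

HB.instance Definition _ := Topological.copy I (set_type (`[0, 1]%classic : set R)).

Definition ival (t : I) : R := sval t.

Lemma ival_inj : injective ival. Proof. exact: val_inj. Qed.

Lemma unit_interval_prop (t : I) : 0 <= ival t <= 1.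
Proof. by case: t => t tI; have := set_mem tI; rewrite /ival /= in_itv. Qed.

Lemma clamp_subproof (r : R) : Num.max 0 (Num.min r 1) \in (`[0, 1]%classic : set R).
Proof.
apply/mem_set; rewrite /= in_itv /=; apply/andP; split.
  by rewrite le_max lexx.
by rewrite ge_max ler01 /= ge_min lexx orbT.
Qed.

Definition clamp (r : R) : I :=
  exist (fun x => x \in (`[0, 1]%classic : set R)) _ (clamp_subproof r).

Lemma ival_clamp (r : R) : 0 <= r <= 1 -> ival (clamp r) = r.
Proof. by move=> /andP[r0 r1]; rewrite /ival /= (min_idPl r1) (max_idPr r0). Qed.

Lemma ivalK_clamp (t : I) : clamp (ival t) = t.
Proof. by apply/ival_inj/ival_clamp/unit_interval_prop. Qed.

Lemma clamp0_neq1 : clamp 0 != clamp 1.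
Proof.
apply/eqP => /(congr1 ival); rewrite !ival_clamp ?lexx ?ler01 //.
by move/eqP; rewrite eq_sym oner_eq0.
Qed.

HB.instance Definition _ := @isBiPointed.Build I (clamp 0) (clamp 1) clamp0_neq1.

Lemma ival_continuous : continuous (ival : I -> R).
Proof. exact: initial_continuous. Qed.

Lemma clamp_continuous : continuous clamp.
Proof.
apply: (@continuous_comp_initial _ _ _ (set_val : (`[0, 1]%classic : set R) -> R)).
move=> x; rewrite /comp /=.
apply: (@continuous_max _ R (cst 0) (fun r => Num.min r 1)); first exact: cst_continuous.
by apply: (@continuous_min _ R id (cst 1)); [exact: cvg_id|exact: cst_continuous].
Qed.
End UnitInterval.
Arguments ival : simpl never.
Arguments clamp : simpl never.

Lemma glue_continuous {R : realType} {X T : topologicalType} (u : X -> R) (c : R)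
    (f g : X -> T) : continuous u -> continuous f -> continuous g ->
  (forall x, u x = c -> f x = g x) ->
  continuous (fun x => if u x <= c then f x else g x).
Proof.
move=> cu cf cg fg.
have cA : closed (u @^-1` [set r | r <= c]).
  by move/continuous_closedP: cu; apply; exact: closed_le.
have cB : closed (u @^-1` [set r | r >= c]).
  by move/continuous_closedP: cu; apply; exact: closed_ge.
have AB : u @^-1` [set r | r <= c] `|` u @^-1` [set r | r >= c] = setT.
  apply/seteqP; split=> // x _ /=.
  by case: (leP (u x) c) => [|/ltW]; [left|right].
apply/continuous_subspace_setT; rewrite -AB.
apply: withinU_continuous => //.
  apply: (@subspace_eq_continuous _ _ _ f); last exact: continuous_subspaceT.
  by move=> x /set_mem /= ux; rewrite /from_subspace ux.
apply: (@subspace_eq_continuous _ _ _ g); last exact: continuous_subspaceT.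
move=> x /set_mem /= ux; rewrite /from_subspace; case: ifPn => // ux'.
by apply/esym/fg/le_anti; rewrite ux ux'.
Qed.

Lemma pair_continuous {X S T : topologicalType} (f : X -> S) (g : X -> T) :
  continuous f -> continuous g -> continuous (fun x => (f x, g x)).
Proof. by move=> cf cg x; exact: (cvg_pair (cf x) (cg x)). Qed.

Lemma comp_continuous {X S T : topologicalType} (f : X -> S) (g : S -> T) :
  continuous f -> continuous g -> continuous (fun x => g (f x)).
Proof. by move=> cf cg x; apply: (@continuous_comp _ _ _ f g); [exact: cf|exact: cg]. Qed.

Section Loops.
Context {R : realType} {T : topologicalType} (x : T).
Local Notation I := (unit_interval R).
Local Notation loop := {path I from x to x in T}.
Implicit Types p q r : loop.

(* homotopy relative to the endpoints *)
Definition loop_homotopic p q : Prop := exists H : I * I -> T,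
  [/\ continuous H, forall t, H (zero, t) = p t, forall t, H (one, t) = q t &
      forall s, H (s, zero) = x /\ H (s, one) = x].

Lemma path_continuous p : continuous p. Proof. exact: cts_fun. Qed.

Lemma loop_homotopic_refl p : loop_homotopic p p.
Proof.
exists (fun z => p z.2); split => //; last by move=> s; rewrite path_zero path_one.
by move=> z; apply: continuous_comp; [exact: cvg_snd|exact: path_continuous].
Qed.

Lemma clampB_continuous : continuous (fun s : I => clamp (1 - ival s)).
Proof.
move=> s; apply: (@continuous_comp _ _ _ (fun s : I => 1 - ival s)); last exact: clamp_continuous.
by apply: continuousB; [exact: cst_continuous|exact: ival_continuous].
Qed.

Lemma clampB0 : clamp (1 - ival (zero : I)) = one.
Proof. by rewrite ival_clamp ?lexx ?ler01 // subr0. Qed.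

Lemma clampB1 : clamp (1 - ival (one : I)) = zero.
Proof. by rewrite ival_clamp ?lexx ?ler01 // subrr. Qed.

Lemma loop_homotopic_sym p q : loop_homotopic p q -> loop_homotopic q p.
Proof.
move=> [H [cH H0 H1 Hx]]; exists (fun z => H (clamp (1 - ival z.1), z.2)); split.
- move=> z; apply: (@continuous_comp _ _ _ (fun z : I * I => (clamp (1 - ival z.1), z.2)));
    last exact: cH.
  apply: pair_continuous; last by move=> ?; exact: cvg_snd.
  by move=> ?; apply: (@continuous_comp _ _ _ fst (fun s : I => clamp (1 - ival s)));
    [exact: cvg_fst|exact: clampB_continuous].
- by move=> t /=; rewrite clampB0.
- by move=> t /=; rewrite clampB1.
- by move=> s; split; case: (Hx (clamp (1 - ival s))).
Qed.

Lemma ival0 : ival (zero : I) = 0. Proof. by rewrite ival_clamp ?lexx ?ler01. Qed.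
Lemma ival1 : ival (one : I) = 1. Proof. by rewrite ival_clamp ?lexx ?ler01. Qed.

Lemma affine_continuous (X : topologicalType) (u : X -> I) (a b : R) :
  continuous u -> continuous (fun z => a * ival (u z) + b : R).
Proof.
move=> cu z; apply: cvgD; last exact: cvg_cst.
apply: cvgM; first exact: cvg_cst.
by apply: continuous_comp; [exact: cu|exact: ival_continuous].
Qed.

Lemma affine_clamp_continuous (X : topologicalType) (u : X -> I) (a b : R) :
  continuous u -> continuous (fun z => clamp (a * ival (u z) + b)).
Proof.
by move=> cu; apply: comp_continuous; [exact: affine_continuous|exact: clamp_continuous].
Qed.

Lemma clamp_le0 (r : R) : r <= 0 -> clamp r = zero.
Proof.
move=> r0; apply: ival_inj; rewrite /ival /= (min_idPl (le_trans r0 ler01)) (max_idPl r0).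
by rewrite (min_idPl ler01) (max_idPl (lexx 0)).
Qed.

Lemma clamp_ge1 (r : R) : 1 <= r -> clamp r = one.
Proof.
by move=> r1; apply: ival_inj; rewrite /ival /= (min_idPr r1) (min_idPr (lexx 1)).
Qed.

Lemma loop_homotopic_trans q p r :
  loop_homotopic p q -> loop_homotopic q r -> loop_homotopic p r.
Proof.
move=> [H [cH H0 H1 Hx]] [K [cK K0 K1 Kx]].
exists (fun z => if ival z.1 <= 2^-1 then H (clamp (2 * ival z.1 + 0), z.2)
                 else K (clamp (2 * ival z.1 + (-1)), z.2)); split.
- refine (glue_continuous (u := fun z : I * I => ival z.1) _ _ _ _).
  + by move=> z; apply: continuous_comp; [exact: cvg_fst|exact: ival_continuous].
  + move=> z; apply: (@continuous_comp _ _ _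
      (fun z : I * I => (clamp (2 * ival z.1 + 0), z.2))); last exact: cH.
    apply: pair_continuous; last by move=> ?; exact: cvg_snd.
    by apply: affine_clamp_continuous => ?; exact: cvg_fst.
  + move=> z; apply: (@continuous_comp _ _ _
      (fun z : I * I => (clamp (2 * ival z.1 + (-1)), z.2))); last exact: cK.
    apply: pair_continuous; last by move=> ?; exact: cvg_snd.
    by apply: affine_clamp_continuous => ?; exact: cvg_fst.
  + move=> z ->; rewrite clamp_ge1; last by lra.
    by rewrite clamp_le0 ?H1 ?K0 //; lra.
- by move=> t /=; rewrite ival0 ifT ?clamp_le0 //; lra.
- by move=> t /=; rewrite ival1 ifF ?clamp_ge1 //; lra.
- by move=> s /=; case: ifP => _; [case: (Hx (clamp (2 * ival s + 0)))
    |case: (Kx (clamp (2 * ival s + (-1))))].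
Qed.

Lemma loop_reparam p (phi psi : I -> I) (q r : loop) :
  continuous phi -> continuous psi ->
  phi zero = psi zero -> phi one = psi one ->
  (forall t, q t = p (phi t)) -> (forall t, r t = p (psi t)) ->
  loop_homotopic q r.
Proof.
move=> cphi cpsi e0 e1 qE rE.
exists (fun z => p (clamp ((1 - ival z.1) * ival (phi z.2) + ival z.1 * ival (psi z.2)))).
have c1 : continuous (fun z : I * I => ival z.1).
  by move=> z; apply: continuous_comp; [exact: cvg_fst|exact: ival_continuous].
have c2 (f : I -> I) : continuous f -> continuous (fun z : I * I => ival (f z.2)).
  move=> cf z; apply: (@continuous_comp _ _ _ snd (ival \o f)); first exact: cvg_snd.
  by apply: continuous_comp; [exact: cf|exact: ival_continuous].
split.
- apply: (@comp_continuous _ _ _ _ p); last exact: path_continuous.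
  move=> z; apply: (@continuous_comp _ _ _ (fun z : I * I =>
    (1 - ival z.1) * ival (phi z.2) + ival z.1 * ival (psi z.2)));
    last exact: clamp_continuous.
  apply: continuousD; apply: continuousM; [|exact: c2|exact: c1|exact: c2].
  by apply: continuousB; [exact: cst_continuous|exact: c1].
- by move=> t /=; rewrite ival0 subr0 mul1r mul0r addr0 ivalK_clamp qE.
- by move=> t /=; rewrite ival1 subrr mul0r mul1r add0r ivalK_clamp rE.
- move=> s /=; rewrite e0 e1 -!mulrDl subrK !mul1r !ivalK_clamp.
  by rewrite -e0 -e1 -!qE path_zero path_one.
Qed.

Definition loop_cat_fun p q (t : I) : T :=
  if ival t <= 2^-1 then p (clamp (2 * ival t + 0)) else q (clamp (2 * ival t + (-1))).

Lemma loop_cat_continuous p q : continuous (loop_cat_fun p q).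
Proof.
refine (glue_continuous (u := ival : I -> R) _ _ _ _); first exact: ival_continuous.
- apply: (@comp_continuous _ _ _ _ p); last exact: path_continuous.
  by apply: (affine_clamp_continuous (u := id)) => ?; exact: cvg_id.
- apply: (@comp_continuous _ _ _ _ q); last exact: path_continuous.
  by apply: (affine_clamp_continuous (u := id)) => ?; exact: cvg_id.
- by move=> z ->; rewrite clamp_ge1 ?clamp_le0 ?path_one ?path_zero //; lra.
Qed.

Lemma loop_cat0 p q : loop_cat_fun p q zero = x.
Proof. by rewrite /loop_cat_fun ival0 ifT ?clamp_le0 ?path_zero //; lra. Qed.

Lemma loop_cat1 p q : loop_cat_fun p q one = x.
Proof. by rewrite /loop_cat_fun ival1 ifF ?clamp_ge1 ?path_one //; lra. Qed.

(* [p] at double speed, then [q] at double speed *)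
Definition loop_cat p q : loop := mk_path (@loop_cat_continuous p q) (loop_cat0 p q) (loop_cat1 p q).

Lemma loop_catE p q (t : I) : loop_cat p q t =
  if ival t <= 2^-1 then p (clamp (2 * ival t + 0)) else q (clamp (2 * ival t + (-1))).
Proof. by []. Qed.

Lemma loop_rev_continuous p : continuous (fun t : I => p (clamp (1 - ival t))).
Proof.
by apply: (@comp_continuous _ _ _ _ p); [exact: clampB_continuous|exact: path_continuous].
Qed.

Lemma loop_rev0 p : p (clamp (1 - ival (zero : I))) = x.
Proof. by rewrite clampB0 path_one. Qed.

Lemma loop_rev1 p : p (clamp (1 - ival (one : I))) = x.
Proof. by rewrite clampB1 path_zero. Qed.

Definition loop_rev p : loop := mk_path (@loop_rev_continuous p) (loop_rev0 p) (loop_rev1 p).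

Lemma loop_cst_continuous : continuous (fun _ : I => x). Proof. exact: cst_continuous. Qed.

Definition loop_cst : loop := mk_path (@loop_cst_continuous) erefl erefl.

Lemma loop_cat_homotopic p p' q q' : loop_homotopic p p' -> loop_homotopic q q' ->
  loop_homotopic (loop_cat p q) (loop_cat p' q').
Proof.
move=> [H [cH H0 H1 Hx]] [K [cK K0 K1 Kx]].
exists (fun z => if ival z.2 <= 2^-1 then H (z.1, clamp (2 * ival z.2 + 0))
                 else K (z.1, clamp (2 * ival z.2 + (-1)))); split.
- refine (glue_continuous (u := fun z : I * I => ival z.2) _ _ _ _).
  + by move=> z; apply: continuous_comp; [exact: cvg_snd|exact: ival_continuous].
  + move=> z; apply: (@continuous_comp _ _ _
      (fun z : I * I => (z.1, clamp (2 * ival z.2 + 0)))); last exact: cH.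
    apply: pair_continuous; first by move=> ?; exact: cvg_fst.
    by apply: affine_clamp_continuous => ?; exact: cvg_snd.
  + move=> z; apply: (@continuous_comp _ _ _
      (fun z : I * I => (z.1, clamp (2 * ival z.2 + (-1))))); last exact: cK.
    apply: pair_continuous; first by move=> ?; exact: cvg_fst.
    by apply: affine_clamp_continuous => ?; exact: cvg_snd.
  + move=> z ->; rewrite clamp_ge1; last by lra.
    rewrite clamp_le0; last by lra.
    by case: (Hx z.1) => _ ->; case: (Kx z.1).
- by move=> t /=; rewrite /mk_path /loop_cat_fun; case: ifP => _; rewrite ?H0 ?K0.
- by move=> t /=; rewrite /mk_path /loop_cat_fun; case: ifP => _; rewrite ?H1 ?K1.
- move=> s /=; rewrite ival0 ival1 ifT; last by lra.
  rewrite ifF; last by lra.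
  rewrite clamp_le0; last by lra.
  rewrite clamp_ge1; last by lra.
  by case: (Hx s) => -> _; case: (Kx s).
Qed.

Lemma loop_rev_homotopic p q : loop_homotopic p q ->
  loop_homotopic (loop_rev p) (loop_rev q).
Proof.
move=> [H [cH H0 H1 Hx]]; exists (fun z => H (z.1, clamp (1 - ival z.2))); split.
- move=> z; apply: (@continuous_comp _ _ _ (fun z : I * I => (z.1, clamp (1 - ival z.2))));
    last exact: cH.
  apply: pair_continuous; first by move=> ?; exact: cvg_fst.
  by move=> ?; apply: (@continuous_comp _ _ _ snd (fun s : I => clamp (1 - ival s)));
    [exact: cvg_snd|exact: clampB_continuous].
- by move=> t /=; rewrite H0.
- by move=> t /=; rewrite H1.
- by move=> s; rewrite clampB0 clampB1; case: (Hx s).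
Qed.

Lemma id_cts : continuous (id : I -> I). Proof. by move=> t; exact: cvg_id. Qed.

Lemma loop_catA p q r : loop_homotopic (loop_cat p (loop_cat q r)) (loop_cat (loop_cat p q) r).
Proof.
pose f (t : I) := Num.max (2^-1 * ival t) (Num.max (ival t - 4^-1) (2 * ival t - 1)).
have fE t : 0 <= f t <= 1.
  have /andP[t0 t1] := unit_interval_prop t.
  by rewrite /f le_max !ge_max; apply/and4P; split; [apply/orP; left|..]; lra.
apply: (@loop_reparam (loop_cat (loop_cat p q) r) (fun t => clamp (f t)) id) => //.
- move=> t; apply: (@continuous_comp _ _ _ f); last exact: clamp_continuous.
  have vc (a b : R) : continuous (fun t : I => a * ival t + b : R).
    by apply: (affine_continuous (u := id)) => ?; exact: cvg_id.
  rewrite (_ : f = (fun t => Num.max (2^-1 * ival t + 0)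
      (Num.max (1 * ival t + - 4^-1) (2 * ival t + (-1))))); last first.
    by apply/funext => s; rewrite /f addr0 mul1r.
  apply: (@continuous_max R _ (fun t : I => 2^-1 * ival t + 0)
    (fun t => Num.max (1 * ival t + - 4^-1) (2 * ival t + (-1)))); first exact: vc.
  by apply: (@continuous_max R _ (fun t : I => 1 * ival t + - 4^-1)); exact: vc.
- exact: id_cts.
- apply: ival_inj; rewrite ival_clamp // /f !ival0 !(mulr0, sub0r).
  rewrite (max_idPl _) // ge_max; apply/andP; split; lra.
- apply: ival_inj; rewrite ival_clamp // /f !ival1.
  rewrite (_ : Num.max (1 - 4^-1 : R) _ = 1).
    by apply/max_idPr; lra.
  by rewrite (max_idPr _); lra.
- move=> t; rewrite [LHS]loop_catE [RHS]loop_catE [loop_cat q r _]loop_catE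
    [loop_cat p q _]loop_catE
    (ival_clamp (fE t)).
  have /andP[t0 t1] := unit_interval_prop t.
  have [th|th] := leP (ival t) 2^-1.
    have -> : f t = 2^-1 * ival t.
      by rewrite /f; apply/max_idPl; rewrite ge_max; apply/andP; split; lra.
    rewrite ifT; last by lra.
    rewrite ival_clamp; last by apply/andP; split; lra.
    by rewrite ifT; [congr (p (clamp _))|]; lra.
  rewrite ival_clamp; last by apply/andP; split; lra.
  have [tq|tq] := leP (2 * ival t + -1) 2^-1.
    have -> : f t = ival t - 4^-1.
      rewrite /f (max_idPl (_ : 2 * ival t - 1 <= ival t - 4^-1)); last by lra.
      by apply/max_idPr; lra.
    rewrite ifT; last by lra.
    rewrite ival_clamp; last by apply/andP; split; lra.
    by rewrite ifF; [congr (q (clamp _))|]; lra.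
  have -> : f t = 2 * ival t - 1.
    rewrite /f (max_idPr (_ : ival t - 4^-1 <= 2 * ival t - 1)); last by lra.
    by apply/max_idPr; lra.
  rewrite ifF; last by lra.
  by congr (r (clamp _)); lra.
Qed.

Lemma loop_cst_cat p : loop_homotopic (loop_cat loop_cst p) p.
Proof.
apply: (@loop_reparam p (fun t => clamp (2 * ival t + (-1))) id) => //.
- by apply: (affine_clamp_continuous (u := id)) => ?; exact: cvg_id.
- exact: id_cts.
- by rewrite ival0 clamp_le0 //; lra.
- by rewrite ival1 clamp_ge1 //; lra.
- move=> t; rewrite loop_catE; case: (leP (ival t)) => // th.
  by rewrite (@clamp_le0 (_ + -1)) ?path_zero //; lra.
Qed.

Lemma loop_cat_cst p : loop_homotopic (loop_cat p loop_cst) p.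
Proof.
apply: (@loop_reparam p (fun t => clamp (2 * ival t + 0)) id) => //.
- by apply: (affine_clamp_continuous (u := id)) => ?; exact: cvg_id.
- exact: id_cts.
- by rewrite ival0 clamp_le0 //; lra.
- by rewrite ival1 clamp_ge1 //; lra.
- move=> t; rewrite loop_catE; case: (leP (ival t)) => // th.
  by rewrite (@clamp_ge1 (_ + 0)) ?path_one //; lra.
Qed.

Lemma tent_cts : continuous (fun t : I => clamp (Num.min (2 * ival t + 0) (-2 * ival t + 2))).
Proof.
have vc (a b : R) : continuous (fun t : I => a * ival t + b : R).
    by apply: (affine_continuous (u := id)) => ?; exact: cvg_id.
move=> t; apply: (@continuous_comp _ _ _
  (fun t : I => Num.min (2 * ival t + 0) (-2 * ival t + 2))); last exact: clamp_continuous.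
by apply: (@continuous_min R _ (fun t : I => 2 * ival t + 0)); exact: vc.
Qed.

Lemma loop_cat_rev p : loop_homotopic (loop_cat p (loop_rev p)) loop_cst.
Proof.
apply: (@loop_reparam p (fun t => clamp (Num.min (2 * ival t + 0) (-2 * ival t + 2)))
  (fun=> zero)).
- exact: tent_cts.
- exact: cst_continuous.
- by rewrite ival0 clamp_le0 // ge_min; apply/orP; left; lra.
- by rewrite ival1 clamp_le0 // ge_min; apply/orP; right; lra.
- move=> t; rewrite loop_catE.
  have /andP[t0 t1] := unit_interval_prop t.
  case: (leP (ival t)) => th.
    by rewrite (min_idPl _) //; lra.
  rewrite /= /mk_path.
  rewrite ival_clamp; last by apply/andP; split; lra.
  by rewrite (min_idPr _); [congr (p (clamp _))|]; lra.
- by move=> t; rewrite path_zero.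
Qed.

Lemma loop_revK p : loop_homotopic (loop_rev (loop_rev p)) p.
Proof.
apply: (@loop_reparam p id id) => //; [exact: id_cts|exact: id_cts|] => t; rewrite /= /mk_path /=.
have /andP[t0 t1] := unit_interval_prop t.
rewrite ival_clamp; last by apply/andP; split; lra.
by rewrite opprB addrC subrK ivalK_clamp.
Qed.

Lemma loop_rev_cat p : loop_homotopic (loop_cat (loop_rev p) p) loop_cst.
Proof.
apply: loop_homotopic_trans (loop_cat_rev (loop_rev p)).
apply: loop_cat_homotopic; first exact: loop_homotopic_refl.
exact/loop_homotopic_sym/loop_revK.
Qed.

Definition loop_rel : rel loop := fun p q => `[< loop_homotopic p q >].
Lemma loop_rel_refl : reflexive loop_rel.
Proof. by move=> p; apply/asboolP/loop_homotopic_refl. Qed.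
Lemma loop_rel_sym : symmetric loop_rel.
Proof.
by move=> p q; apply/asboolP/asboolP; exact: loop_homotopic_sym.
Qed.
Lemma loop_rel_trans : transitive loop_rel.
Proof.
move=> q p r /asboolP pq /asboolP qr.
by apply/asboolP; exact: loop_homotopic_trans pq qr.
Qed.

Definition loop_equiv := EquivRel loop_rel loop_rel_refl loop_rel_sym loop_rel_trans.
End Loops.

Arguments loop_equiv R {T} x.

Definition pi1 (R : realType) (T : topologicalType) (x : T) :=
  {eq_quot loop_equiv R x}%qT.
Arguments pi1 R {T} x.

Section FundamentalGroup.
Context {R : realType} {T : topologicalType} (x : T).
Local Notation I := (unit_interval R).
Local Notation loop := {path I from x to x in T}.

HB.instance Definition _ := Choice.on (pi1 R x).
HB.instance Definition _ := EqQuotient.on (pi1 R x).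

Definition pi1_class (p : loop) : pi1 R x := \pi_(pi1 R x)%qT p.

Lemma pi1_classP (p q : loop) : loop_homotopic p q <-> pi1_class p = pi1_class q.
Proof. by split=> [?|/eqmodP/asboolP//]; apply/eqmodP/asboolP. Qed.

Lemma pi1_class_repr (a : pi1 R x) : pi1_class (repr a) = a.
Proof. exact: reprK. Qed.

Lemma repr_class (p : loop) : loop_homotopic (repr (pi1_class p)) p.
Proof. by apply/pi1_classP; rewrite pi1_class_repr. Qed.

Definition pi1_mul (a b : pi1 R x) := pi1_class (loop_cat (repr a) (repr b)).
Definition pi1_inv (a : pi1 R x) := pi1_class (loop_rev (repr a)).
Definition pi1_one : pi1 R x := pi1_class (loop_cst x).

Lemma pi1_mulE p q : pi1_mul (pi1_class p) (pi1_class q) = pi1_class (loop_cat p q).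
Proof. by apply/pi1_classP/loop_cat_homotopic; exact: repr_class. Qed.

Lemma pi1_invE p : pi1_inv (pi1_class p) = pi1_class (loop_rev p).
Proof. exact/pi1_classP/loop_rev_homotopic/repr_class. Qed.

Let mulA : associative pi1_mul.
Proof.
move=> a b c; rewrite -[a]pi1_class_repr -[b]pi1_class_repr -[c]pi1_class_repr.
rewrite !pi1_mulE; exact/pi1_classP/loop_catA.
Qed.
Let mul1 : left_id pi1_one pi1_mul.
Proof.
move=> a; rewrite -[a]pi1_class_repr pi1_mulE; exact/pi1_classP/loop_cst_cat.
Qed.
Let mulr1 : right_id pi1_one pi1_mul.
Proof.
move=> a; rewrite -[a]pi1_class_repr pi1_mulE; exact/pi1_classP/loop_cat_cst.
Qed.
Let mulV : left_inverse pi1_one pi1_inv pi1_mul.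
Proof.
move=> a; rewrite -[a]pi1_class_repr pi1_invE pi1_mulE.
exact/pi1_classP/loop_rev_cat.
Qed.
Let mulrV : right_inverse pi1_one pi1_inv pi1_mul.
Proof.
move=> a; rewrite -[a]pi1_class_repr pi1_invE pi1_mulE.
exact/pi1_classP/loop_cat_rev.
Qed.

HB.instance Definition _ := isGroup.Build (pi1 R x) mulA mul1 mulr1 mulV mulrV.
End FundamentalGroup.

Definition pi1_map (R : realType) (S T : topologicalType) (f : continuousType S T)
    (x : S) (a : pi1 R x) : pi1 R (f x) :=
  pi1_class (f \o repr a : {path unit_interval R from f x to f x in T}).

Lemma pi1_map_class (R : realType) (S T : topologicalType) (f : continuousType S T)
    (x : S) (p : {path unit_interval R from x to x in S}) :
  pi1_map f (pi1_class p) =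
  pi1_class (f \o p : {path unit_interval R from f x to f x in T}).
Proof.
have [H [cH H0 H1 Hx]] := repr_class p.
apply/pi1_classP; exists (f \o H); split.
- by move=> z; apply: continuous_comp; [exact: cH|exact: cts_fun].
- by move=> t /=; rewrite H0.
- by move=> t /=; rewrite H1.
- by move=> s /=; case: (Hx s) => -> ->.
Qed.

Local Obligation Tactic := idtac.

HB.mixin Record isTopologicalGroup G & Group G & Topological G := {
  mulg_continuous : continuous (fun z : G * G => (z.1 * z.2)%g);
  invg_continuous : continuous (fun x : G => x^-1%g)
}.

#[short(type="topologicalGroupType")]
HB.structure Definition TopologicalGroup :=
  {G of Group G & Topological G & isTopologicalGroup G}.

Definition is_subgroup (G : groupType) (A : set G) : Prop :=
  [/\ A 1%g, forall x y, A x -> A y -> A (x * y)%g & forall x, A x -> A x^-1%g].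

Definition left_coset (G : groupType) (N : set G) (g : G) : set G :=
  [set (g * n)%g | n in N].

Record fin_normal (G : groupType) := FinNormal {
  fin_normal_set :> set G;
  fin_normal_subgroup : is_subgroup fin_normal_set;
  fin_normalJ : forall g n, fin_normal_set n -> fin_normal_set (g * n * g^-1)%g;
  fin_normal_index : finite_set (range (left_coset fin_normal_set))
}.

(* the inverse limit of the finite quotients [G / N], whose elements are the
   compatible families of cosets *)
Record profinite_completion (G : groupType) := Profin {
  profin_val :> forall N : fin_normal G, discrete_topology (set G);
  profin_coset : forall N, exists g, profin_val N = left_coset N g;
  profin_compat : forall M N : fin_normal G,
    M `<=` N -> profin_val M `<=` profin_val N
}.

Section Profinite.
Context {G : groupType}.
Implicit Types (N : fin_normal G) (x y z : profinite_completion G).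

HB.instance Definition _ := gen_eqMixin (fin_normal G).
HB.instance Definition _ := gen_eqMixin (profinite_completion G).
HB.instance Definition _ := gen_choiceMixin (profinite_completion G).
HB.instance Definition _ := Topological.copy (profinite_completion G)
  (initial_topology (fun x : profinite_completion G =>
     (x : prod_topology (fun N : fin_normal G => discrete_topology (set G))))).

Lemma profin_eq x y : (forall N, x N = y N) -> x = y.
Proof.
case: x y => [x xc xm] [y yc ym] /= xy; have E : x = y by exact/functional_extensionality_dep.
by subst y; congr Profin; exact: Prop_irrelevance.
Qed.

Lemma left_cosetM N g h :
  [set (a * b)%g | a in left_coset N g & b in left_coset N h] = left_coset N (g * h)%g.
Proof.
have [N1 NM NV] := fin_normal_subgroup N.
apply/seteqP; split => [_ [_ [n Nn <-] [_ [n' Nn' <-] <-]]|_ [n Nn <-]].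
  exists ((h^-1 * n * h) * n')%g.
    by apply: NM => //; rewrite -{2}[h]invgK; exact: fin_normalJ.
  by rewrite !mulgA mulgK.
exists g; first by exists 1%g => //; rewrite mulg1.
by exists (h * n)%g; [exists n|rewrite mulgA].
Qed.

Lemma left_cosetV N g :
  [set (a^-1)%g | a in left_coset N g] = left_coset N g^-1%g.
Proof.
have [N1 NM NV] := fin_normal_subgroup N.
apply/seteqP; split => [_ [_ [n Nn <-] <-]|_ [n Nn <-]].
  exists (g * n^-1 * g^-1)%g; first by apply: fin_normalJ; exact: NV.
  by rewrite invgM !mulgA mulVg mul1g.
exists (n^-1 * g)%g; last by rewrite invgM invgK.
exists (g^-1 * n^-1 * g)%g; last by rewrite !mulgA mulgV mul1g.
by rewrite -{2}[g]invgK; apply/fin_normalJ/NV.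
Qed.

Program Definition profin_mul x y : profinite_completion G :=
  @Profin G (fun N => [set (a * b)%g | a in x N & b in y N]) _ _.
Next Obligation.
move=> x y N /=; have [g ->] := profin_coset x N; have [h ->] := profin_coset y N.
by exists (g * h)%g; exact: left_cosetM.
Qed.
Next Obligation.
move=> x y M N MN _ [a xa [b yb <-]]; exists a; first exact: profin_compat xa.
by exists b => //; exact: profin_compat yb.
Qed.

Program Definition profin_inv x : profinite_completion G :=
  @Profin G (fun N => [set a^-1%g | a in x N]) _ _.
Next Obligation.
move=> x N /=; have [g ->] := profin_coset x N; exists g^-1%g; exact: left_cosetV.
Qed.
Next Obligation.
move=> x M N MN _ [a xa <-]; exists a => //; exact: profin_compat xa.
Qed.

Program Definition to_profin (g : G) : profinite_completion G :=
  @Profin G (fun N => left_coset N g) _ _.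
Next Obligation. by move=> g N; exists g. Qed.
Next Obligation. by move=> g M N MN _ [n /MN Nn <-]; exists n. Qed.

Let mulA : associative profin_mul.
Proof.
move=> x y z; apply: profin_eq => N /=.
have [a ->] := profin_coset x N; have [b ->] := profin_coset y N.
have [c ->] := profin_coset z N.
by rewrite !left_cosetM mulgA.
Qed.

Let mul1 : left_id (to_profin 1%g) profin_mul.
Proof.
move=> x; apply: profin_eq => N /=; have [a ->] := profin_coset x N.
by rewrite left_cosetM mul1g.
Qed.

Let mulr1 : right_id (to_profin 1%g) profin_mul.
Proof.
move=> x; apply: profin_eq => N /=; have [a ->] := profin_coset x N.
by rewrite left_cosetM mulg1.
Qed.

Let mulV : left_inverse (to_profin 1%g) profin_inv profin_mul.
Proof.
move=> x; apply: profin_eq => N /=; have [a ->] := profin_coset x N.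
by rewrite left_cosetV left_cosetM mulVg.
Qed.

Let mulrV : right_inverse (to_profin 1%g) profin_inv profin_mul.
Proof.
move=> x; apply: profin_eq => N /=; have [a ->] := profin_coset x N.
by rewrite left_cosetV left_cosetM mulgV.
Qed.

HB.instance Definition _ := isGroup.Build (profinite_completion G) mulA mul1 mulr1 mulV mulrV.

Lemma to_profinM : {morph to_profin : g h / (g * h)%g}.
Proof. by move=> g h; apply: profin_eq => N /=; rewrite left_cosetM. Qed.

Lemma near_profin x N : nbhs x [set y : profinite_completion G | y N = x N].
Proof.
have c : continuous (fun y : profinite_completion G => y N).
  move=> y; apply: (@continuous_comp _ _ _
    (fun x : profinite_completion G => (x : prod_topology (fun N : fin_normal G => discrete_topology (set G))))
    (fun f => f N)).
    exact: initial_continuous.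
  exact: (@proj_continuous _ (fun N : fin_normal G => discrete_topology (set G)) N).
by apply: (c x [set x N]); exact: discrete_set1.
Qed.

Lemma profin_continuous (X : topologicalType) (f : X -> profinite_completion G) :
  (forall a N, nbhs a [set b | f b N = f a N]) -> continuous f.
Proof.
move=> fN; apply: continuous_comp_initial => a.
apply/cvg_sup => N.
suff : continuous ((fun b => f b : prod_topology (fun N : fin_normal G => discrete_topology (set G)))
  : X -> initial_topology (fun g : prod_topology (fun N : fin_normal G => discrete_topology (set G)) => g N)).
  exact.
apply: continuous_comp_initial => b U; rewrite nbhs_principalE => UN.
by have := fN b N; apply: filterS => c /= ->; exact: UN.
Qed.

Let mul_continuous : continuous (fun z : profinite_completion G * profinite_completion G => (z.1 * z.2)%g).
Proof.
apply: profin_continuous => -[a b] N.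
have := near_profin b N; have := near_profin a N => na nb.
exists ([set y : profinite_completion G | y N = a N], [set y : profinite_completion G | y N = b N]) => //.
by move=> [c d] [/= ca db]; rewrite /= ca db.
Qed.

Let inv_continuous : continuous (fun x : profinite_completion G => x^-1%g).
Proof.
apply: profin_continuous => a N; have := near_profin a N.
by apply: filterS => b E; congr (image _ _); exact: E.
Qed.

HB.instance Definition _ :=
  isTopologicalGroup.Build (profinite_completion G) mul_continuous inv_continuous.
End Profinite.

Record topgroup_iso (G H : topologicalGroupType) := TopGroupIso {
  iso_fun :> G -> H;
  iso_inv : H -> G;
  iso_funK : cancel iso_fun iso_inv;
  iso_invK : cancel iso_inv iso_fun;
  iso_funM : {morph iso_fun : x y / (x * y)%g};
  iso_fun_continuous : continuous iso_fun;
  iso_inv_continuous : continuous iso_inv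
}.

Record open_subgroup (G : topologicalGroupType) := OpenSubgroup {
  open_subgroup_set :> set G;
  open_subgroup_subgroup : is_subgroup open_subgroup_set;
  open_subgroup_open : open open_subgroup_set
}.

Section ImageOpenSubgroup.
Context {G H : topologicalGroupType} (Phi : topgroup_iso G H) (U : open_subgroup G).

Lemma image_open_subgroup_subgroup : is_subgroup (Phi @` U).
Proof.
have [U1 UM UV] := open_subgroup_subgroup U.
have Phi1 : Phi 1%g = 1%g.
  by apply: (@mulgI _ (Phi 1%g)); rewrite -iso_funM !mulg1.
split.
- by exists 1%g.
- by move=> _ _ [x Ux <-] [y Uy <-]; exists (x * y)%g; [exact: UM|rewrite iso_funM].
- move=> _ [x Ux <-]; exists x^-1%g; first exact: UV.
  by apply: (@mulgI _ (Phi x)); rewrite -iso_funM !mulgV.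
Qed.

Lemma image_open_subgroup_open : open (Phi @` U).
Proof.
rewrite (_ : Phi @` U = iso_inv Phi @^-1` U).
  have /continuousP := @iso_inv_continuous _ _ Phi; apply.
  exact: open_subgroup_open.
apply/seteqP; split=> [_ [x Ux <-]|y Uy]; first by rewrite /= iso_funK.
by exists (iso_inv Phi y) => //; exact: iso_invK.
Qed.

(* the underlying set is [Phi @` U] *)
Definition image_open_subgroup : open_subgroup H :=
  OpenSubgroup image_open_subgroup_subgroup image_open_subgroup_open.
End ImageOpenSubgroup.

Definition conj_set (G : groupType) (x : G) (A : set G) : set G :=
  [set (x * a * x^-1)%g | a in A].

Definition conj_class (G : groupType) (A : set G) : set (set G) :=
  range (fun x => conj_set x A).

Definition cyclic_subgroup (G : groupType) (m : G) : set G :=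
  [set x | exists n : nat, x = (m ^+ n)%g \/ x = (m ^- n)%g].

Definition closed_cyclic (G : groupType) (m : G) : set (profinite_completion G) :=
  closure (to_profin @` cyclic_subgroup m).

Definition closed_inertia (G : groupType) (m : G)
    (U : open_subgroup (profinite_completion G)) (x : profinite_completion G) :
    set (profinite_completion G) :=
  U `&` conj_set x (closed_cyclic m).

Definition sphere (R : realType) (n : nat) : set 'rV[R]_n.+1 :=
  [set x | \sum_i x 0 i ^+ 2 = 1].

Arguments sphere : clear implicits.

Definition disk (R : realType) (n : nat) : set 'rV[R]_n :=
  [set x | \sum_i x 0 i ^+ 2 <= 1].

Arguments disk : clear implicits.

Definition homeomorphism (X Y : topologicalType) (f : X -> Y) : Prop :=
  continuous f /\
  exists g : Y -> X, [/\ cancel f g, cancel g f & continuous g].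

Definition open_embedding (X Y : topologicalType) (f : X -> Y) : Prop :=
  [/\ continuous f, injective f & forall U, open U -> open (f @` U)].

Section Knots.
Context {R : realType}.
Local Notation S1 := (sphere R 1).
Local Notation S3 := (sphere R 3).
Implicit Types (K N : set S3).

Definition knot K : Prop :=
  exists f : S1 -> S3, [/\ continuous f, injective f & range f = K].

(* radial projection to the sphere of the segment from [p] to [q]: the minimal
   great-circle arc when [p] and [q] are not antipodal *)
Definition geodesic_arc (p q : S3) : set S3 :=
  [set x | exists2 t : R, 0 <= t <= 1 &
     exists2 c : R, 0 < c & val x = c *: ((1 - t) *: val p + t *: val q)].

Definition polygonal (P : set S3) : Prop :=
  exists2 s : seq (S3 * S3), (forall e, e \in s -> val e.1 != - val e.2) &
    P = [set x | exists2 e, e \in s & geodesic_arc e.1 e.2 x].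

Definition tame_knot K : Prop :=
  knot K /\ exists2 f : S3 -> S3, homeomorphism f & polygonal (f @` K).

Definition trivial_knot K : Prop :=
  exists2 f : S3 -> S3, homeomorphism f &
    f @` K = [set x : S3 | forall i : 'I_4, (1 < i)%N -> val x 0 i = 0].

(* [N] is a closed tubular neighbourhood of [K]; extending the parametrization
   by the solid torus to an open embedding excludes a wild boundary torus *)
Definition tubular_nbhd K N : Prop :=
  exists h : S1 * 'rV[R]_2 -> S3,
    [/\ open_embedding h, h @` [set z | z.2 = 0] = K &
        h @` [set z | disk R 2 z.2] = N].

Definition exterior N : set S3 := ~` N°.

(* the boundary of the exterior, as a manifold, is its frontier in [S3] *)
Definition exterior_boundary N : set (exterior N) :=
  [set x | ~ (exterior N)° (val x)].

Arguments exterior_boundary : clear implicits.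

Definition boundary_incl N (x : exterior_boundary N) : exterior N := val x.

Lemma boundary_incl_continuous N : continuous (@boundary_incl N).
Proof. exact: initial_continuous. Qed.

HB.instance Definition _ N :=
  isContinuous.Build _ _ (@boundary_incl N) (@boundary_incl_continuous N).

Definition knot_group N (x0 : exterior_boundary N) := pi1 R (boundary_incl x0).

HB.instance Definition _ N (x0 : exterior_boundary N) :=
  Group.on (knot_group x0).

Definition peripheral_map N (x0 : exterior_boundary N) :
  pi1 R x0 -> knot_group x0 := @pi1_map R _ _ (@boundary_incl N) x0.

Definition simple_loop (X : topologicalType) (x : X)
    (c : {path unit_interval R from x to x}) : Prop :=
  forall s t, c s = c t ->
    [\/ s = t, s = zero /\ t = one | s = one /\ t = zero].

(* at [p] the pair [(D, K)] looks like a plane and a line crossing it in 3-space *)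
Definition crosses_at (D K : set S3) (p : S3) : Prop :=
  exists h : 'rV[R]_2 * R -> S3,
    [/\ open_embedding h, h (0, 0) = p, h @^-1` D = [set v | v.2 = 0] &
        h @^-1` K = [set v | v.1 = 0]].

(* The disk meets [K] once in the usual, transverse, sense: a disk that only
   touches [K] may bound a null-homotopic curve of the boundary torus. *)
Definition is_meridian K N (x0 : exterior_boundary N) (mu : pi1 R x0) : Prop :=
  exists c : {path unit_interval R from x0 to x0},
    [/\ mu = pi1_class c, simple_loop c &
    exists d : disk R 2 -> S3,
      [/\ continuous d, injective d, range d `<=` N,
          d @` [set z | sphere R 1 (val z)] = range (fun t => val (val (c t))) &
          exists2 p, range d `&` K = [set p] & crosses_at (range d) K p]].
End Knots.

Arguments exterior_boundary {R} N.

(* Main.v *)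
Require Import Defs.
From mathcomp Require Import all_boot all_order all_algebra.
From mathcomp Require Import all_classical reals topology normedtype.
Set Implicit Arguments.
Unset Strict Implicit.
Unset Printing Implicit Defensive.
Import numFieldNormedType.Exports.
Local Open Scope classical_set_scope.

(** The theorem is a transport of structure along [Phi]: a group
    isomorphism [Phi] turns conjugation by [x] into conjugation by
    [Phi x].  Hence, if [Phi] carries [A] to [y B y^-1], it carries [x A x^-1]
    to [(Phi x y) B (Phi x y)^-1], and, being injective, it carries
    [U `&` x A x^-1] to [Phi U `&` (Phi x y) B (Phi x y)^-1].  The
    statements on inertia are the case where [A] and [B] are the closures of
    the subgroups generated by the two meridians.

    The bijection between the two families then comes from the reindexing
    [x |-> Phi x y] of the conjugating elements, which is onto because [Phi]
    is; injectivity on the families is that of direct image along [Phi]. *)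

Section ConjugateSets.
Context {G : groupType}.
Implicit Types (A : set G) (x y : G).

Lemma conj_set1 A : conj_set 1%g A = A.
Proof.
rewrite /conj_set; under eq_imagel do rewrite mul1g invg1 mulg1.
exact: image_id.
Qed.

Lemma conj_setM x y A : conj_set x (conj_set y A) = conj_set (x * y)%g A.
Proof.
rewrite /conj_set image_comp; apply: eq_imagel => a _ /=.
by rewrite invgM !mulgA.
Qed.

End ConjugateSets.

Section TransportConjugates.
Context {G H : topologicalGroupType} (Phi : topgroup_iso G H).
Implicit Types (A : set G) (B : set H).

Lemma iso_fun_inj : injective Phi.
Proof. exact: can_inj (@iso_funK _ _ Phi). Qed.

Lemma iso_fun1 : Phi 1%g = 1%g.
Proof. by apply: (@mulgI _ (Phi 1%g)); rewrite -iso_funM !mulg1. Qed.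

Lemma iso_funV x : Phi x^-1%g = (Phi x)^-1%g.
Proof. by apply: (@mulgI _ (Phi x)); rewrite -iso_funM !mulgV iso_fun1. Qed.

(** Inertia subgroups are intersections, with which direct image commutes
    only because [Phi] is injective. *)
Lemma image_iso_setI A A' : Phi @` (A `&` A') = Phi @` A `&` Phi @` A'.
Proof.
apply/seteqP; split=> [_ [a [Aa A'a] <-]|_ [[a Aa <-] [a' A'a' /iso_fun_inj E]]].
  by split; exists a.
by exists a => //; split=> //; rewrite -E.
Qed.

Lemma image_iso_inj : injective (fun A => Phi @` A).
Proof.
apply: (can_inj (g := fun B => iso_inv Phi @` B)) => A /=.
rewrite image_comp -[RHS]image_id; apply: eq_imagel => a _ /=.
exact: iso_funK.
Qed.

Lemma image_conj_set x A : Phi @` conj_set x A = conj_set (Phi x) (Phi @` A).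
Proof.
rewrite /conj_set !image_comp; apply: eq_imagel => a _ /=.
by rewrite !iso_funM iso_funV.
Qed.

(** This is why the reindexing [x |-> Phi x y] of the conjugating elements
    misses no conjugate, and hence no inertia subgroup, on the target side. *)
Lemma iso_mulr_surj y z : exists x, (Phi x * y)%g = z.
Proof. by exists (iso_inv Phi (z * y^-1)%g); rewrite iso_invK mulgVK. Qed.

Lemma image_conj_set_translate A B y x :
  Phi @` A = conj_set y B -> Phi @` conj_set x A = conj_set (Phi x * y)%g B.
Proof. by move=> AB; rewrite image_conj_set AB conj_setM. Qed.

(** One conjugate determines the whole class: [A] is a member of its own
    class, and all the other members are translates of it. *)
Lemma image_conj_classP A B :
  [set Phi @` C | C in conj_class A] = conj_class B <->
  exists y, Phi @` A = conj_set y B.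
Proof.
split=> [AB|[y AB]].
  have : conj_class B (Phi @` A).
    by rewrite -AB; exists A => //; exists 1%g => //; rewrite conj_set1.
  by case=> y _ <-; exists y.
apply/seteqP; split=> [_ [_ [x _ <-] <-]|_ [z _ <-]].
  by exists (Phi x * y)%g => //; rewrite (image_conj_set_translate _ AB).
have [x <-] := iso_mulr_surj y z.
exists (conj_set x A); first by exists x.
exact: image_conj_set_translate.
Qed.

End TransportConjugates.

Section TransportInertia.
Context {G G' : groupType}.
Variable Phi : topgroup_iso (profinite_completion G) (profinite_completion G').
Variables (m : G) (m' : G') (y : profinite_completion G').
Hypothesis Phi_m : Phi @` closed_cyclic m = conj_set y (closed_cyclic m').
Variable U : open_subgroup (profinite_completion G).
Let U' := image_open_subgroup Phi U.

Lemma image_closed_inertia x :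
  Phi @` closed_inertia m U x = closed_inertia m' U' (Phi x * y)%g.
Proof.
by rewrite /closed_inertia image_iso_setI (image_conj_set_translate _ Phi_m).
Qed.

Lemma closed_inertia_bij :
  set_bij (range (closed_inertia m U)) (range (closed_inertia m' U'))
    (fun I => Phi @` I).
Proof.
split=> [_ [x _ <-]|I J _ _|_ [z _ <-]].
- by exists (Phi x * y)%g => //; rewrite image_closed_inertia.
- exact: image_iso_inj.
- have [x <-] := iso_mulr_surj Phi y z.
  exists (closed_inertia m U x); first by exists x.
  exact: image_closed_inertia.
Qed.

End TransportInertia.

Theorem theorem5p2 (R : realType) (K K' N N' : set (sphere R 3))
    (tame_K : tame_knot K) (tame_K' : tame_knot K')
    (nontrivial_K : ~ trivial_knot K)
    (tub_N : tubular_nbhd K N) (tub_N' : tubular_nbhd K' N')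
    (x0 : exterior_boundary N) (x0' : exterior_boundary N')
    (mu : pi1 R x0) (mu' : pi1 R x0')
    (meridian_mu : is_meridian K mu) (meridian_mu' : is_meridian K' mu')
    (m : knot_group x0) (m' : knot_group x0')
    (m_def : m = peripheral_map mu) (m'_def : m' = peripheral_map mu')
    (Phi : topgroup_iso (profinite_completion (knot_group x0))
                        (profinite_completion (knot_group x0'))) :
  ([set Phi @` A | A in conj_class (closed_cyclic m)]
     = conj_class (closed_cyclic m') <->
   exists y, Phi @` closed_cyclic m = conj_set y (closed_cyclic m')) /\
  ([set Phi @` A | A in conj_class (closed_cyclic m)]
     = conj_class (closed_cyclic m') ->
   forall y : profinite_completion (knot_group x0'),
     Phi @` closed_cyclic m = conj_set y (closed_cyclic m') ->
   forall U : open_subgroup (profinite_completion (knot_group x0)),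
     let U' := image_open_subgroup Phi U in
     (forall x : profinite_completion (knot_group x0),
        Phi @` closed_inertia m U x = closed_inertia m' U' (Phi x * y)%g) /\
     set_bij (range (closed_inertia m U)) (range (closed_inertia m' U'))
       (fun I => Phi @` I)).
Proof.
split; first exact: image_conj_classP.
move=> _ y Phi_m U; split=> [x|]; first exact: image_closed_inertia.
exact: closed_inertia_bij Phi_m U.
Qed.
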